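(* Let $(\boldsymbol u,p)\in\mathbf K\times V$ be the solution of the continuous Biot contact problem, and let $(\boldsymbol u_N,p_M)\in\mathbf K_N\times V_M$ be the solution of the discrete problem \[ a(\boldsymbol u_N,\boldsymbol v_N-\boldsymbol u_N)-b(\boldsymbol v_N-\boldsymbol u_N,p_M)\ge\langle\boldsymbol f_e,\boldsymbol v_N-\boldsymbol u_N\rangle\ \ \forall\boldsymbol v_N\in\mathbf K_N,\qquad -b(\boldsymbol u_N,q_M)-c(p_M,q_M)=\langle f_f,q_M\rangle\ \ \forall q_M\in V_M. \] Then \begin{align*} \|\boldsymbol u-\boldsymbol u_N\|_{\mathbf V}^2&\le 42\,\|\boldsymbol u-\boldsymbol v_N\|_{\mathbf V}^2+12\,\|p-q_M\|_V^2+4\,\langle\boldsymbol\sigma_{\boldsymbol n}(\boldsymbol u,p),(\boldsymbol v_N-\boldsymbol u+\boldsymbol v-\boldsymbol u_N)\cdot\boldsymbol n\rangle_{\Gamma_c},\\ \|p-p_M\|_V^2&\le 126\,\|\boldsymbol u-\boldsymbol v_N\|_{\mathbf V}^2+39\,\|p-q_M\|_V^2+12\,\langle\boldsymbol\sigma_{\boldsymbol n}(\boldsymbol u,p),(\boldsymbol v_N-\boldsymbol u+\boldsymbol v-\boldsymbol u_N)\cdot\boldsymbol n\rangle_{\Gamma_c} \end{align*} for all $\boldsymbol v\in\mathbf K$, all $\boldsymbol v_N\in\mathbf K_N$ and all $q_M\in V_M$.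
   Context: Setting. $\Omega\subset\mathbb R^d$, $d\in\{2,3\}$, is a bounded Lipschitz domain with boundary $\Gamma$ and outward unit normal $\boldsymbol n$. The boundary is decomposed twice into non-overlapping parts, $\Gamma=\Gamma_p\cup\Gamma_f=\Gamma_c\cup\Gamma_d\cup\Gamma_t$, with $\Gamma_p$ and $\Gamma_d$ of positive surface measure and $\overline{\Gamma_d}\cap\overline{\Gamma_c}=\emptyset$. Parameters: constants $\tau,\iota,\alpha>0$ and a symmetric, uniformly positive definite matrix $\boldsymbol\kappa$ (bounded, $d\times d$). Spaces: $V=\{v\in H^1(\Omega): v|_{\Gamma_p}=0\}$ and $\mathbf V=\{\boldsymbol v\in [H^1(\Omega)]^d:\boldsymbol v|_{\Gamma_d}=\mathbf 0\}$, with duals $V^*$, $\mathbf V^*$ and duality pairings $\langle\cdot,\cdot\rangle$; $(\cdot,\cdot)$ is the $L^2(\Omega)$ inner product. With $\boldsymbol\varepsilon(\boldsymbol u)=\frac12(\nabla\boldsymbol u+\nabla^\top\boldsymbol u)$, the bilinear forms are \[a(\boldsymbol u,\boldsymbol v)=2\tau(\boldsymbol\varepsilon(\boldsymbol u),\boldsymbol\varepsilon(\boldsymbol v))+\iota(\operatorname{div}\boldsymbol u,\operatorname{div}\boldsymbol v),\quad b(\boldsymbol u,q)=\alpha(\operatorname{div}\boldsymbol u,q),\quad c(p,q)=\tfrac{\alpha^2}{\iota}(p,q)+(\boldsymbol\kappa\nabla p,\nabla q).\] Norms: $\|\boldsymbol v\|_{\mathbf V}^2=a(\boldsymbol v,\boldsymbol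 v)$ and $\|q\|_V^2=c(q,q)$ (equivalent to the $H^1$ norms). Data: $\boldsymbol f_e\in\mathbf V^*$, $f_f\in V^*$, $g\in H^{1/2}(\Gamma_c)$. With the normal trace $\boldsymbol v_{\boldsymbol n}=\boldsymbol v|_{\Gamma_c}\cdot\boldsymbol n$, let $\mathbf K=\{\boldsymbol v\in\mathbf V:\boldsymbol v_{\boldsymbol n}\le g\text{ on }\Gamma_c\}$, assumed non-empty. Continuous Biot contact problem: $(\boldsymbol u,p)\in\mathbf K\times V$ is the unique pair with $a(\boldsymbol u,\boldsymbol v-\boldsymbol u)-b(\boldsymbol v-\boldsymbol u,p)\ge\langle\boldsymbol f_e,\boldsymbol v-\boldsymbol u\rangle$ for all $\boldsymbol v\in\mathbf K$ and $-b(\boldsymbol u,q)-c(p,q)=\langle f_f,q\rangle$ for all $q\in V$. Contact pressure: $\boldsymbol\sigma_{\boldsymbol n}(\boldsymbol u,p)$ is the functional on normal traces determined by $\langle\boldsymbol\sigma_{\boldsymbol n}(\boldsymbol u,p),\boldsymbol v_{\boldsymbol n}\rangle_{\Gamma_c}=a(\boldsymbol u,\boldsymbol v)-b(\boldsymbol v,p)-\langle\boldsymbol f_e,\boldsymbol v\rangle$ for all $\boldsymbol v\in\mathbf V$. Discretization: $\mathbf V_N\subset\mathbf V$ and $V_M\subset V$ are finite dimensional subspaces, and $\mathbf K_N\subset\mathbf V_N$ is a non-empty, closed, convex set, not necessarily contained in $\mathbf K$. The discrete problem has exactly one solution. *)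

(* Defs.v *)
From HB Require Import structures.
From mathcomp Require Import all_boot all_order all_algebra.
From mathcomp Require Import all_classical all_reals all_analysis.

Set Implicit Arguments.
Unset Strict Implicit.
Unset Printing Implicit Defensive.

Import Order.TTheory GRing.Theory Num.Theory.
Import numFieldNormedType.Exports.

Local Open Scope classical_set_scope.
Local Open Scope ring_scope.

(* The ambient space R^d is ['rV[R]_n.+1] with d = n.+1, so that n is the
   dimension of the boundary.  The library norm on row vectors is the sup
   norm: it is only used through the topology, and Euclidean lengths are
   always written with [enorm]. *)

Definition dotp (R : realType) (n : nat) (x y : 'rV[R]_n) : R :=
  \sum_i x 0 i * y 0 i.

Definition enorm (R : realType) (n : nat) (x : 'rV[R]_n) : R :=
  Num.sqrt (dotp x x).

(* [mu_ext] covers with measurable sets only; this alias, in which every set is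
   measurable, makes it cover with arbitrary sets, their cost being given by a
   gauge (+oo on the sets that are not allowed). *)
Definition any_set (T : Type) : Type := T.

HB.instance Definition _ (T : pointedType) := Pointed.on (any_set T).
HB.instance Definition _ (T : pointedType) :=
  @isMeasurable.Build default_measure_display (any_set T)
    discrete_measurable (@discrete_measurable0 T)
    (@discrete_measurableC T) (@discrete_measurableU T).

(* Volume of the smallest closed box containing [U], +oo if there is none. *)
Definition box_gauge (R : realType) (n : nat)
    (U : set (any_set 'rV[R]_n.+1)) : \bar R :=
  ereal_inf [set (\prod_i (ab.2 0 i - ab.1 0 i))%:E | ab in
    [set ab : 'rV[R]_n.+1 * 'rV[R]_n.+1 |
      (forall i, ab.1 0 i <= ab.2 0 i) /\
      forall x : 'rV[R]_n.+1, U x -> forall i, ab.1 0 i <= x 0 i <= ab.2 0 i]].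

Lemma box_gauge_ge0 (R : realType) (n : nat) (U : set (any_set 'rV[R]_n.+1)) :
  (0 <= box_gauge U)%E.
Proof.
apply: le_ereal_inf_tmp => _ [[a b] /= [ab _] <-].
by rewrite lee_fin; apply: prodr_ge0 => i _; rewrite subr_ge0.
Qed.

Lemma box_gauge0 (R : realType) (n : nat) :
  box_gauge (set0 : set (any_set 'rV[R]_n.+1)) = 0%E.
Proof.
apply/eqP; rewrite eq_le box_gauge_ge0 andbT.
apply: ereal_inf_lbound; exists (0, 0); first by split => [i|x []].
by rewrite /= big_ord_recl subrr mul0r.
Qed.

Definition lebesgue_outer (R : realType) (n : nat) (A : set 'rV[R]_n.+1) :
  \bar R := mu_ext (@box_gauge R n) A.

HB.instance Definition _ (R : realType) (n : nat) :=
  isOuterMeasure.Build R 'rV[R]_n.+1 (@lebesgue_outer R n)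
    (mu_ext0 (@box_gauge0 R n) (@box_gauge_ge0 R n))
    (mu_ext_ge0 (@box_gauge_ge0 R n))
    (le_mu_ext (@box_gauge R n))
    (mu_ext_sigma_subadditive (@box_gauge_ge0 R n)).

(* Volume of the unit ball of R^k: omega_k = (2 pi / k) omega_(k - 2). *)
Fixpoint ball_volume (R : realType) (k : nat) : R :=
  match k with
  | 0 => 1
  | 1 => 2
  | (k'.+1 as k1).+1 => 2 * pi / k1.+1%:R * ball_volume R k'
  end.

(* omega_n (diam U / 2)^n, restricted to the sets of diameter at most delta. *)
Definition diam_gauge (R : realType) (n : nat) (delta : R)
    (U : set (any_set 'rV[R]_n.+1)) : \bar R :=
  if `[< forall x y : 'rV[R]_n.+1, U x -> U y -> enorm (x - y) <= delta >]
  then ereal_sup ([set 0%E] `|`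
    [set (ball_volume R n / 2 ^+ n * enorm (xy.1 - xy.2) ^+ n)%:E | xy in
      [set xy : 'rV[R]_n.+1 * 'rV[R]_n.+1 | U xy.1 /\ U xy.2]])
  else +oo%E.

Lemma diam_gauge_ge0 (R : realType) (n : nat) (delta : R)
  (U : set (any_set 'rV[R]_n.+1)) : (0 <= diam_gauge delta U)%E.
Proof.
rewrite /diam_gauge; case: asboolP => [_|_]; last exact: leey.
by apply: ereal_sup_ubound; left.
Qed.

Lemma diam_gauge0 (R : realType) (n : nat) (delta : R) :
  diam_gauge delta (set0 : set (any_set 'rV[R]_n.+1)) = 0%E.
Proof.
apply/eqP; rewrite eq_le diam_gauge_ge0 andbT /diam_gauge asboolT//.
by apply: ge_ereal_sup => _ [->//|[xy [[]]]].
Qed.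

Definition hausdorff_outer (R : realType) (n : nat) (A : set 'rV[R]_n.+1) :
    \bar R :=
  ereal_sup [set mu_ext (@diam_gauge R n delta) A | delta in [set r | 0 < r]].

Section hausdorff_outer_measure.
Context (R : realType) (n : nat).
Local Notation H := (@hausdorff_outer R n).

Let hausdorff_outer_ge0 A : (0 <= H A)%E.
Proof.
apply: (@le_trans _ _ (mu_ext (@diam_gauge R n 1) A)).
  exact: mu_ext_ge0 (@diam_gauge_ge0 R n 1) A.
by apply: ereal_sup_ubound; exists 1 => //=.
Qed.

Let hausdorff_outer0 : H set0 = 0%E.
Proof.
apply/eqP; rewrite eq_le hausdorff_outer_ge0 andbT.
apply: ge_ereal_sup => _ [d _ <-].
by rewrite (mu_ext0 (@diam_gauge0 R n d) (@diam_gauge_ge0 R n d)).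
Qed.

Let le_hausdorff_outer : {homo H : A B / A `<=` B >-> (A <= B)%E}.
Proof.
move=> A B AB; apply: ge_ereal_sup => _ [d d0 <-].
apply: (le_trans (le_mu_ext (@diam_gauge R n d) AB)).
by apply: ereal_sup_ubound; exists d.
Qed.

Let hausdorff_outer_sigma_subadditive : sigma_subadditive H.
Proof.
move=> F; apply: ge_ereal_sup => _ [d d0 <-].
apply: (le_trans (mu_ext_sigma_subadditive (@diam_gauge_ge0 R n d) F)).
apply: lee_nneseries => [k _ _|k _].
  exact: mu_ext_ge0 (@diam_gauge_ge0 R n d) (F k).
by apply: ereal_sup_ubound; exists d.
Qed.

HB.instance Definition _ := isOuterMeasure.Build R 'rV[R]_n.+1 H
  hausdorff_outer0 hausdorff_outer_ge0 le_hausdorff_outer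
  hausdorff_outer_sigma_subadditive.

End hausdorff_outer_measure.

(* Restricting the outer measure rather than the measure gives a measure on
   the whole space for every set D, with no measurability proof for D; for
   D measurable, its measurable sets are the A with A `&` D measurable. *)
Definition outer_restr (R : realType) (T : Type) (mu : set T -> \bar R)
  (D A : set T) : \bar R := mu (A `&` D).

Section outer_restriction.
Context (R : realType) (T : Type) (mu : {outer_measure set T -> \bar R}).
Context (D : set T).

Let outer_restr0 : outer_restr mu D set0 = 0%E.
Proof. by rewrite /outer_restr set0I outer_measure0. Qed.

Let outer_restr_ge0 A : (0 <= outer_restr mu D A)%E.
Proof. exact: outer_measure_ge0. Qed.

Let le_outer_restr : {homo outer_restr mu D : A B / A `<=` B >-> (A <= B)%E}.
Proof. by move=> A B AB; apply: le_outer_measure; exact: setSI. Qed.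

Let outer_restr_sigma_subadditive : sigma_subadditive (outer_restr mu D).
Proof.
move=> F; rewrite /outer_restr setI_bigcupl.
exact: outer_measure_sigma_subadditive.
Qed.

HB.instance Definition _ := isOuterMeasure.Build R T (outer_restr mu D)
  outer_restr0 outer_restr_ge0 le_outer_restr outer_restr_sigma_subadditive.

End outer_restriction.

Definition lebesgue_outer_on (R : realType) (n : nat) (Omega : set 'rV[R]_n.+1) :
    {outer_measure set 'rV[R]_n.+1 -> \bar R} :=
  outer_restr (@lebesgue_outer R n) Omega.

Definition lebesgue_on (R : realType) (n : nat) (Omega : set 'rV[R]_n.+1) :
    {measure set (caratheodory_type (lebesgue_outer_on Omega)) -> \bar R} :=
  (lebesgue_outer_on Omega : set (caratheodory_type (lebesgue_outer_on Omega)) -> \bar R).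

(* Surface measure on S, when S lies in the boundary of a Lipschitz domain. *)
Definition surface_outer_on (R : realType) (n : nat) (S : set 'rV[R]_n.+1) :
    {outer_measure set 'rV[R]_n.+1 -> \bar R} :=
  outer_restr (@hausdorff_outer R n) S.

Definition surface_on (R : realType) (n : nat) (S : set 'rV[R]_n.+1) :
    {measure set (caratheodory_type (surface_outer_on S)) -> \bar R} :=
  (surface_outer_on S : set (caratheodory_type (surface_outer_on S)) -> \bar R).

(* The boundary, Omega being open. *)
Definition bnd (R : realType) (n : nat) (Omega : set 'rV[R]_n.+1) :
  set 'rV[R]_n.+1 := closure Omega `\` Omega.

(* Near each boundary point x, Omega lies below the graph, in the direction nu,
   of a Lipschitz function phi of the component orthogonal to nu. *)
Definition lipschitz_domain (R : realType) (n : nat)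
    (Omega : set 'rV[R]_n.+1) : Prop :=
  [/\ open Omega, connected Omega, Omega !=set0, bounded_set Omega &
   forall x, bnd Omega x -> exists (nu : 'rV[R]_n.+1) (r L : R)
      (phi : 'rV[R]_n.+1 -> R),
    [/\ enorm nu = 1, 0 < r,
      (forall y z, `|phi y - phi z| <= L * enorm (y - z)) &
      forall y, enorm (y - x) < r ->
        (Omega y <->
         dotp (y - x) nu < phi ((y - x) - dotp (y - x) nu *: nu))]].

(* nu is orthogonal to the tangent hyperplane of the boundary at x, and points
   outwards: near x, Omega agrees with a half-space up to o(|y - x|). *)
Definition is_outer_normal (R : realType) (n : nat) (Omega : set 'rV[R]_n.+1)
    (x nu : 'rV[R]_n.+1) : Prop :=
  enorm nu = 1 /\
  forall e : R, 0 < e -> \forall y \near x,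
    (dotp (y - x) nu < - (e * enorm (y - x)) -> Omega y) /\
    (e * enorm (y - x) < dotp (y - x) nu -> ~ Omega y).

(* For a Lipschitz domain it exists, and is unique, at almost every boundary
   point. *)
Definition outer_normal (R : realType) (n : nat) (Omega : set 'rV[R]_n.+1)
    (x : 'rV[R]_n.+1) : 'rV[R]_n.+1 :=
  xget 0 [set nu | is_outer_normal Omega x nu].

(* Pieces may share surface-null sets only. *)
Definition boundary_piece (R : realType) (n : nat) (Omega S : set 'rV[R]_n.+1) :
    Prop :=
  S `<=` bnd Omega /\ (@hausdorff_outer R n).-caratheodory S.

Definition non_overlapping (R : realType) (n : nat) (S T : set 'rV[R]_n.+1) :
  Prop := hausdorff_outer (S `&` T) = 0%E.

Definition partial (R : realType) (n : nat) (i : 'I_n.+1)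
    (phi : 'rV[R]_n.+1 -> R) (x : 'rV[R]_n.+1) : R :=
  'D_(delta_mx 0 i) phi x.

Fixpoint C_k (R : realType) (n k : nat) (phi : 'rV[R]_n.+1 -> R) : Prop :=
  match k with
  | 0 => continuous phi
  | k'.+1 => (forall x, differentiable phi x) /\
             forall i, C_k k' (partial i phi)
  end.

Definition smooth (R : realType) (n : nat) (phi : 'rV[R]_n.+1 -> R) : Prop :=
  forall k, C_k k phi.

Definition test_function (R : realType) (n : nat) (Omega : set 'rV[R]_n.+1)
    (phi : 'rV[R]_n.+1 -> R) : Prop :=
  smooth phi /\ exists K : set 'rV[R]_n.+1,
    [/\ compact K, K `<=` Omega & forall x, ~ K x -> phi x = 0].

(* An element of H^1(Omega) is carried together with its weak gradient, which
   it determines almost everywhere; sums, multiples and differences are those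
   of pairs of functions.  Values outside Omega are irrelevant. *)
Definition scalar_field (R : realType) (n : nat) : Type :=
  (('rV[R]_n.+1 -> R) * ('rV[R]_n.+1 -> 'rV[R]_n.+1))%type.

Definition vector_field (R : realType) (n : nat) : Type := 'I_n.+1 -> scalar_field R n.

Definition H1 (R : realType) (n : nat) (Omega : set 'rV[R]_n.+1)
    (v : scalar_field R n) : Prop :=
  [/\ v.1 \in Lfun (lebesgue_on Omega) 2%:E,
    (forall i, (fun x => v.2 x 0 i) \in Lfun (lebesgue_on Omega) 2%:E) &
    forall (phi : 'rV[R]_n.+1 -> R) (i : 'I_n.+1), test_function Omega phi ->
      \int[lebesgue_on Omega]_x (v.1 x * partial i phi x)
        = - \int[lebesgue_on Omega]_x (v.2 x 0 i * phi x)].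

Definition H1_norm (R : realType) (n : nat) (Omega : set 'rV[R]_n.+1)
    (v : scalar_field R n) : R :=
  Num.sqrt (\int[lebesgue_on Omega]_x (v.1 x ^+ 2)
            + \int[lebesgue_on Omega]_x dotp (v.2 x) (v.2 x)).

Definition H1_vnorm (R : realType) (n : nat) (Omega : set 'rV[R]_n.+1)
    (u : vector_field R n) : R :=
  Num.sqrt (\sum_i H1_norm Omega (u i) ^+ 2).

Definition with_gradient (R : realType) (n : nat) (phi : 'rV[R]_n.+1 -> R) :
  scalar_field R n := (phi, fun x => \row_i partial i phi x).

(* w is the trace of v on the boundary: the limit in L^2 of the restrictions
   of smooth functions tending to v in H^1(Omega).  The two memberships
   required of phi_ k hold for every smooth function when Omega is a bounded
   Lipschitz domain. *)
Definition is_trace (R : realType) (n : nat) (Omega : set 'rV[R]_n.+1)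
    (v : scalar_field R n) (w : 'rV[R]_n.+1 -> R) : Prop :=
  w \in Lfun (surface_on (bnd Omega)) 2%:E /\
  exists phi_ : nat -> 'rV[R]_n.+1 -> R,
    [/\ (forall k, [/\ smooth (phi_ k), H1 Omega (with_gradient (phi_ k)) &
                       phi_ k \in Lfun (surface_on (bnd Omega)) 2%:E]),
      H1_norm Omega (v - with_gradient (phi_ k)) @[k --> \oo] --> 0 &
      \int[surface_on (bnd Omega)]_x ((w x - phi_ k x) ^+ 2) @[k --> \oo] --> 0].

Definition H1_vanishing (R : realType) (n : nat)
    (Omega S : set 'rV[R]_n.+1) (v : scalar_field R n) : Prop :=
  H1 Omega v /\ exists w, is_trace Omega v w /\
    {ae surface_on S, forall x, w x = 0}.

Definition H1_vvanishing (R : realType) (n : nat)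
    (Omega S : set 'rV[R]_n.+1) (u : vector_field R n) : Prop :=
  forall i, H1_vanishing Omega S (u i).

(* s is (almost everywhere on S) the normal component of the trace of u. *)
Definition is_normal_trace (R : realType) (n : nat)
    (Omega S : set 'rV[R]_n.+1) (u : vector_field R n) (s : 'rV[R]_n.+1 -> R) : Prop :=
  exists w : 'I_n.+1 -> 'rV[R]_n.+1 -> R,
    (forall i, is_trace Omega (u i) (w i)) /\
    {ae surface_on S, forall x, s x = \sum_i w i x * outer_normal Omega x 0 i}.

Definition normal_trace (R : realType) (n : nat)
    (Omega S : set 'rV[R]_n.+1) (u : vector_field R n) : 'rV[R]_n.+1 -> R :=
  xget (fun=> 0) [set s | is_normal_trace Omega S u s].

(* H^{1/2}(S), by the Gagliardo-Slobodeckij seminorm; S has dimension n. *)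
Definition H_half (R : realType) (n : nat) (S : set 'rV[R]_n.+1)
    (g : 'rV[R]_n.+1 -> R) : Prop :=
  g \in Lfun (surface_on S) 2%:E /\
  (\int[surface_on S]_x \int[surface_on S]_y
     ((g x - g y) ^+ 2 / enorm (x - y) ^+ n.+1)%:E < +oo)%E.

(* F belongs to the dual of the subspace W normed by nrm. *)
Definition in_dual (R : realType) (E : lmodType R) (W : set E) (nrm : E -> R)
    (F : E -> R) : Prop :=
  (forall (a : R) (u v : E), W u -> W v -> F (a *: u + v) = a * F u + F v) /\
  exists C : R, forall v, W v -> `|F v| <= C * nrm v.

Definition finite_dim_subspace (R : realType) (E : lmodType R) (W V : set E) :
    Prop :=
  W `<=` V /\ exists (N : nat) (e : 'I_N -> E),
    W = [set \sum_i c i *: e i | c in [set: 'I_N -> R]].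

Definition norm_closed (R : realType) (E : lmodType R) (nrm : E -> R)
    (W K : set E) : Prop :=
  forall (k_ : nat -> E) (v : E), (forall j, K (k_ j)) -> W v ->
    nrm (k_ j - v) @[j --> \oo] --> 0 -> K v.

Definition permeability (R : realType) (n : nat) (Omega : set 'rV[R]_n.+1)
    (kappa : 'rV[R]_n.+1 -> 'M[R]_n.+1) : Prop :=
  [/\ (forall i j, measurable_fun
       [set: caratheodory_type (lebesgue_outer_on Omega)] (fun x => kappa x i j)),
    (forall x, Omega x -> (kappa x)^T = kappa x),
    (exists k1 : R, forall x, Omega x -> forall i j, `|kappa x i j| <= k1) &
    exists k0 : R, 0 < k0 /\ forall x, Omega x -> forall xi : 'rV[R]_n.+1,
      k0 * dotp xi xi <= dotp (xi *m (kappa x)^T) xi].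

Definition divg (R : realType) (n : nat) (u : vector_field R n) (x : 'rV[R]_n.+1) : R :=
  \sum_i (u i).2 x 0 i.

Definition strain (R : realType) (n : nat) (u : vector_field R n) (x : 'rV[R]_n.+1) :
    'M[R]_n.+1 :=
  \matrix_(i, j) (((u i).2 x 0 j + (u j).2 x 0 i) / 2).

Definition form_a (R : realType) (n : nat) (Omega : set 'rV[R]_n.+1)
    (tau iota : R) (u v : vector_field R n) : R :=
  2 * tau * \int[lebesgue_on Omega]_x (\sum_i \sum_j strain u x i j * strain v x i j)
  + iota * \int[lebesgue_on Omega]_x (divg u x * divg v x).

Definition form_b (R : realType) (n : nat) (Omega : set 'rV[R]_n.+1)
    (alpha : R) (u : vector_field R n) (q : scalar_field R n) : R :=
  alpha * \int[lebesgue_on Omega]_x (divg u x * q.1 x).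

(* As row vectors, kappa grad p is (grad p) *m kappa^T. *)
Definition form_c (R : realType) (n : nat) (Omega : set 'rV[R]_n.+1)
    (iota alpha : R) (kappa : 'rV[R]_n.+1 -> 'M[R]_n.+1) (p q : scalar_field R n) : R :=
  alpha ^+ 2 / iota * \int[lebesgue_on Omega]_x (p.1 x * q.1 x)
  + \int[lebesgue_on Omega]_x dotp (p.2 x *m (kappa x)^T) (q.2 x).

Definition norm_a (R : realType) (n : nat) (Omega : set 'rV[R]_n.+1)
    (tau iota : R) (u : vector_field R n) : R :=
  Num.sqrt (form_a Omega tau iota u u).

Definition norm_c (R : realType) (n : nat) (Omega : set 'rV[R]_n.+1)
    (iota alpha : R) (kappa : 'rV[R]_n.+1 -> 'M[R]_n.+1) (q : scalar_field R n) : R :=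
  Num.sqrt (form_c Omega iota alpha kappa q q).

Definition contact_set (R : realType) (n : nat)
    (Omega Gd Gc : set 'rV[R]_n.+1) (g : 'rV[R]_n.+1 -> R) : set (vector_field R n) :=
  [set v | H1_vvanishing Omega Gd v /\ exists s,
    is_normal_trace Omega Gc v s /\ {ae surface_on Gc, forall x, s x <= g x}].

(* Used for the continuous problem and for the discrete one. *)
Definition biot_solution (R : realType) (n : nat) (Omega : set 'rV[R]_n.+1)
    (tau iota alpha : R) (kappa : 'rV[R]_n.+1 -> 'M[R]_n.+1)
    (fe : vector_field R n -> R) (ff : scalar_field R n -> R)
    (K : set (vector_field R n)) (V : set (scalar_field R n)) (u : vector_field R n) (p : scalar_field R n) :
    Prop :=
  [/\ K u, V p,
    (forall v, K v -> form_a Omega tau iota u (v - u)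
       - form_b Omega alpha (v - u) p >= fe (v - u)) &
    forall q, V q -> - form_b Omega alpha u q
       - form_c Omega iota alpha kappa p q = ff q].

(* The identity determines sigma on all normal traces. *)
Definition is_contact_pressure (R : realType) (n : nat)
    (Omega Gd Gc : set 'rV[R]_n.+1) (tau iota alpha : R) (fe : vector_field R n -> R)
    (u : vector_field R n) (p : scalar_field R n) (sigma : ('rV[R]_n.+1 -> R) -> R) : Prop :=
  forall (v : vector_field R n) (s : 'rV[R]_n.+1 -> R),
    H1_vvanishing Omega Gd v -> is_normal_trace Omega Gc v s ->
    sigma s = form_a Omega tau iota u v - form_b Omega alpha v p - fe v.

(* Main.v *)
Require Import Defs.
From HB Require Import structures.
From mathcomp Require Import all_boot all_order all_algebra.
From mathcomp Require Import all_classical all_reals all_analysis.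
Import Order.TTheory GRing.Theory Num.Theory.
Import numFieldNormedType.Exports.
Local Open Scope classical_set_scope.
Local Open Scope ring_scope.
From mathcomp Require Import measurable_realfun ring lra.

Set Implicit Arguments.
Unset Strict Implicit.
Unset Printing Implicit Defensive.

(* With e = u - uN, eta = u - vN, r = p - pM, xi = p - qM and z the argument of
   the contact pressure, testing both variational inequalities and the Galerkin
   orthogonality b(e, q) + c(r, q) = 0 gives
     |e|^2 + |r|^2 <= a(e, eta) - b(eta, r) + b(e, xi) + c(r, xi) + <sigma, z>.
   The form b has norm at most 1 in the energy norms, so 4 s t <= s^2 + 4 t^2
   absorbs half of the left-hand side in the first four terms.

   The contact pressure can be evaluated at z only once H^1 functions with
   vanishing trace are known to form a group under addition.  Adding up the
   weak gradient identities requires v * phi to be integrable, hence test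
   functions to be measurable for the Caratheodory sigma-algebra of the
   Lebesgue outer measure: its box gauge splits additively along coordinate
   hyperplanes, so that half-spaces, cubes and open sets are measurable. *)

(** * Borel sets are Lebesgue measurable *)

Lemma box_gauge_le (R : realType) (n : nat) (U : set (any_set 'rV[R]_n.+1))
    (a b : 'rV[R]_n.+1) :
  (forall i, a 0 i <= b 0 i) ->
  (forall x : 'rV[R]_n.+1, U x -> forall i, a 0 i <= x 0 i <= b 0 i) ->
  (box_gauge U <= (\prod_i (b 0 i - a 0 i))%:E)%E.
Proof. by move=> ab Uab; apply: ereal_inf_lbound; exists (a, b). Qed.

Definition halfspace (R : realType) (n : nat) (i : 'I_n.+1) (c : R) :
  set 'rV[R]_n.+1 := [set x | x 0 i <= c].

(* Cutting a box by the hyperplane x_i = c, clamped to the box, yields two boxes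
   whose volumes add up. *)
Lemma box_gauge_split (R : realType) (n : nat) (i : 'I_n.+1) (c : R)
    (U : set (any_set 'rV[R]_n.+1)) :
  (box_gauge (U `&` halfspace i c)
   + box_gauge (U `&` (~` halfspace i c)) <= box_gauge U)%E.
Proof.
apply: le_ereal_inf_tmp => _ [[a b] /= [ab Uab] <-].
pose c' := Num.max (a 0 i) (Num.min (b 0 i) c).
have ac' : a 0 i <= c' by rewrite le_max lexx.
have c'b : c' <= b 0 i by rewrite ge_max ab ge_min lexx.
pose b1 : 'rV[R]_n.+1 := \row_j (if j == i then c' else b 0 j).
pose a2 : 'rV[R]_n.+1 := \row_j (if j == i then c' else a 0 j).
have le1 : (box_gauge (U `&` halfspace i c)
    <= (\prod_j (b1 0 j - a 0 j))%:E)%E.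
  apply: box_gauge_le => [j|x [Ux /= xc] j].
    by rewrite mxE; case: eqP => [->|_].
  have /andP[-> xb] := Uab _ Ux j; rewrite mxE; case: eqP => [ji|_//].
  by rewrite le_max le_min -ji xb ji xc orbT.
have le2 : (box_gauge (U `&` (~` halfspace i c))
    <= (\prod_j (b 0 j - a2 0 j))%:E)%E.
  apply: box_gauge_le => [j|x [Ux /= xc] j].
    by rewrite mxE; case: eqP => [->|_].
  have /andP[xa ->] := Uab _ Ux j; rewrite mxE; case: eqP => [ji|_].
    rewrite ge_max -ji xa ge_min ji andbT/=.
    by move/negP: xc; rewrite -ltNge => /ltW ->; rewrite orbT.
  by rewrite xa.
apply: (le_trans (leeD le1 le2)); rewrite -EFinD lee_fin.
(* The three products differ in the factor of index [i] only, where the two lengths telescope at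
   [c']. *)
rewrite (bigD1 i)//= [X in _ + X](bigD1 i)//= [leRHS](bigD1 i)//= !mxE eqxx.
rewrite (eq_bigr (fun j => b 0 j - a 0 j)); last first.
  by move=> j /negbTE ji; rewrite mxE ji.
rewrite [X in _ + _ * X](eq_bigr (fun j => b 0 j - a 0 j)); last first.
  by move=> j /negbTE ji; rewrite mxE ji.
by rewrite -mulrDl addrC addrA subrK.
Qed.

(** Subadditivity leaves one inequality to prove. Any cover [F] of [X] is cut by the hyperplane into
    covers of the two parts of [X], and [box_gauge_split] shows that their costs add up to at most
    that of [F]. *)
Lemma halfspace_caratheodory (R : realType) (n : nat) (i : 'I_n.+1) (c : R) :
  (@lebesgue_outer R n).-caratheodory (halfspace i c).
Proof.
apply: (@le_caratheodory_measurable _ _ (@lebesgue_outer R n)) => X.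
apply: le_ereal_inf_tmp => _ [F [_ XF] <-].
pose G b k : set (any_set 'rV[R]_n.+1) := F k `&`
  (if b : bool then halfspace i c else (~` halfspace i c)).
have Gge0 b k : (0 <= box_gauge (G b k))%E := box_gauge_ge0 _.
have le b : (lebesgue_outer (X `&` (if b then halfspace i c
      else (~` halfspace i c))) <= \sum_(k <oo) box_gauge (G b k))%E.
  apply: ereal_inf_lbound; exists (G b) => //; split=> // x [Xx Hx].
  by have [k _ Fk] := XF _ Xx; exists k => //; split.
apply: (le_trans (leeD (le true) (le false))); rewrite -nneseriesD//.
by apply: lee_nneseries => [k _ _|k _]; rewrite ?adde_ge0// box_gauge_split.
Qed.

(** The splitting identity of the restriction at [X] is that of [mu] at the intersection of [X] and
    [D]. *)
Lemma outer_restr_caratheodory (R : realType) (T : Type)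
    (mu : {outer_measure set T -> \bar R}) (D A : set T) :
  mu.-caratheodory A -> (outer_restr mu D).-caratheodory A.
Proof. by move=> mA X; rewrite /outer_restr mA setIAC [X in (_ + mu X)%E]setIAC. Qed.

(** For [r > 0] this is the open sup-norm ball, written by coordinates so that its measurability
    follows from that of the coordinates. *)
Definition cube (R : realType) (n : nat) (a : 'rV[R]_n.+1) (r : R) :
  set 'rV[R]_n.+1 := [set x | forall i, `|x 0 i - a 0 i| < r].

(** Centres are rational and radii are inverses of positive integers, so the union is countable. *)
Lemma open_bigcup_cubes (R : realType) (n : nat) (U : set 'rV[R]_n.+1) : open U ->
  U = \bigcup_(qk in [set qk : 'rV[rat]_n.+1 * nat |
        cube (map_mx ratr qk.1) qk.2.+1%:R^-1 `<=` U])
      cube (map_mx ratr qk.1) qk.2.+1%:R^-1.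
Proof.
move=> oU; apply/seteqP; split=> [x Ux|x [qk qkU]]; last exact: qkU.
have /nbhs_ballP[e /= e0 eU] : nbhs x U by exact: open_nbhs_nbhs.
have [k ke] : exists k : nat, k.+1%:R^-1 < e / 4.
  have [k _ kP] := near_infty_natSinv_lt (PosNum (divr_gt0 e0 (ltr0Sn R 3))).
  by exists k; apply: kP => /=.
have k0 : 0 < k.+1%:R^-1 :> R by rewrite invr_gt0.
set d : R := k.+1%:R^-1 in ke k0.
have /choice[q qP] : forall i, exists q : rat, `|x 0 i - ratr q| < d.
  move=> i; have h : x 0 i - d < x 0 i + d by lra.
  have [q] := rat_in_itvoo h.
  by rewrite in_itv/= => qx; exists q; rewrite distrC ltr_distl.
exists (\row_i q i, k) => /= [|i]; last by rewrite !mxE.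
(* Each coordinate of [y] is within [d] of the centre, itself within [d] of [x], and [2 * d < e]. *)
move=> y yP; apply: eU; split=> // i0 i; rewrite (ord1 i0) /ball/=.
have := qP i; have := yP i; rewrite !mxE -/d !ltr_norml => /andP[? ?] /andP[? ?].
by apply/andP; split; lra.
Qed.

Section lebesgue_on.
Context (R : realType) (n : nat) (Omega : set 'rV[R]_n.+1).
Local Notation mu := (lebesgue_on Omega).
Local Notation T := (caratheodory_type (lebesgue_outer_on Omega)).

Lemma measurable_halfspace (i : 'I_n.+1) (c : R) :
  measurable (halfspace i c : set T).
Proof. exact/outer_restr_caratheodory/halfspace_caratheodory. Qed.

Lemma measurable_coord (i : 'I_n.+1) :
  measurable_fun setT (fun x : T => (x : 'rV[R]_n.+1) 0 i).
Proof.
apply: (measurability _ (RGenOInfty.measurableE R)).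
move=> _ [_ [c ->] <-]; rewrite setTI.
rewrite [X in measurable X](_ : _ = (~` halfspace i c)).
  exact/measurableC/measurable_halfspace.
apply/seteqP; split=> x /=; rewrite in_itv/= andbT.
  by move=> cx; apply/negP; rewrite -ltNge.
by move/negP; rewrite -ltNge.
Qed.

Lemma measurable_cube (a : 'rV[R]_n.+1) (r : R) : measurable (cube a r : set T).
Proof.
rewrite [X in measurable X](_ : _ = \bigcap_(i in [set: 'I_n.+1])
    [set x | `|(x : 'rV[R]_n.+1) 0 i - a 0 i| < r]).
  apply: fin_bigcap_measurable => // i _.
  rewrite [X in measurable X](_ : _ = setT `&`
      (fun x : T => (x : 'rV[R]_n.+1) 0 i) @^-1` `]a 0 i - r, a 0 i + r[).
    exact: measurable_coord.
  by rewrite setTI; apply/seteqP; split=> x /=; rewrite in_itv/= -ltr_distl.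
by apply/seteqP; split=> x h i; [move=> _; exact: h|exact: h].
Qed.

Lemma measurable_open (U : set 'rV[R]_n.+1) : open U -> measurable (U : set T).
Proof.
(* The condition on the index moves into the sets, so that the union runs over a whole countable
   type. *)
move=> /open_bigcup_cubes ->; rewrite bigcup_mkcond.
apply: countable_bigcupT_measurable => // qk.
by case: ifP => _ //; exact: measurable_cube.
Qed.

Lemma continuous_measurable (phi : 'rV[R]_n.+1 -> R) : continuous phi ->
  measurable_fun [set: T] (phi : T -> R).
Proof.
move=> cphi; apply: (measurability _ (RGenOInfty.measurableE R)).
move=> _ [_ [c ->] <-]; rewrite setTI; apply: measurable_open.
by move/continuousP: cphi; apply; exact: rray_open.
Qed.

(** Every set is measurable for the outer measure restricted to it: inside [Omega], the part of a
    test set lying outside [Omega] is empty. *)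
Lemma measurable_domain : measurable (Omega : set T).
Proof.
move=> X; change (lebesgue_outer (X `&` Omega) =
  (lebesgue_outer (X `&` Omega `&` Omega) +
   lebesgue_outer (X `&` ~` Omega `&` Omega))%E).
rewrite -setIA setIid -setIA setICl setI0.
by rewrite (outer_measure0 (@lebesgue_outer R n)) adde0.
Qed.

Lemma measure_outside : mu (~` Omega) = 0%E.
Proof.
change (lebesgue_outer (~` Omega `&` Omega) = 0%E).
by rewrite setICl (outer_measure0 (@lebesgue_outer R n)).
Qed.

(** One box of half-width [M] contains [Omega]. Finite measure is what makes square-integrable
    functions integrable. *)
Lemma lebesgue_on_fin_num : bounded_set Omega -> mu setT \is a fin_num.
Proof.
move=> /pinfty_ex_gt0[M M0 OM]; rewrite ge0_fin_numE//.
have OM' (x : 'rV[R]_n.+1) : Omega x -> forall i, - M <= x 0 i <= M.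
  move=> Ox i; rewrite -ler_norml; apply: le_trans (OM _ Ox).
  rewrite /Num.norm/= mx_normrE.
  by apply: (le_bigmax _ (fun ij : 'I_1 * 'I_n.+1 => `|x ij.1 ij.2|) (0, i)).
(* Covers are sequences: the single set [Omega] is followed by empty sets of cost 0. *)
pose F k : set (any_set 'rV[R]_n.+1) := if k == 0%N then Omega else set0.
have le1 : (mu setT <= \sum_(k <oo) box_gauge (F k))%E.
  apply: ereal_inf_lbound; exists F => //.
  by split=> // x [_ Ox]; exists 0%N.
apply: (le_lt_trans le1); rewrite nneseries_recl//; last first.
  by move=> k _; exact: box_gauge_ge0.
rewrite eseries0 ?adde0; last by case=> // k _ _; exact: box_gauge0.
apply: (@le_lt_trans _ _ (\prod_(i < n.+1) ((const_mx M : 'rV[R]_n.+1) 0 i -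
    (const_mx (- M) : 'rV[R]_n.+1) 0 i))%:E); last exact: ltry.
apply: box_gauge_le => [i|x Ox i]; rewrite !mxE; last exact: OM'.
by rewrite ge0_cp// ltW.
Qed.

End lebesgue_on.

(** * Square-integrable functions *)

Section integrable_real_functions.
Context d (T : measurableType d) (R : realType) (mu : {measure set T -> \bar R}).
Implicit Types f g h : T -> R.

Lemma integrable_realD f g : mu.-integrable setT (EFin \o f) ->
  mu.-integrable setT (EFin \o g) ->
  mu.-integrable setT (EFin \o (fun x => f x + g x)).
Proof. by move=> fi gi; have := integrableD measurableT fi gi. Qed.

Lemma integrable_realZ k f : mu.-integrable setT (EFin \o f) ->
  mu.-integrable setT (EFin \o (fun x => k * f x)).
Proof. by move=> fi; have := integrableZl measurableT k fi. Qed.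

Lemma integrable_real_sum (I : finType) (f : I -> T -> R) :
  (forall i, mu.-integrable setT (EFin \o f i)) ->
  mu.-integrable setT (EFin \o (fun x => \sum_i f i x)).
Proof.
move=> fi; have := @integrable_sum _ _ _ mu _ measurableT _ (index_enum I) xpredT
  (fun i => EFin \o f i) (fun i _ => fi i).
by congr (_.-integrable); apply/funext => x; rewrite /= -sumEFin.
Qed.

Lemma Lfun2_integrableM f g : f \in Lfun mu 2%:E -> g \in Lfun mu 2%:E ->
  mu.-integrable setT (EFin \o (fun x => f x * g x)).
Proof. by move=> f2 g2; exact/Lfun1_integrable/Lfun2_mul_Lfun1. Qed.

Lemma Lfun2B f g : f \in Lfun mu 2%:E -> g \in Lfun mu 2%:E ->
  (fun x => f x - g x) \in Lfun mu 2%:E.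
Proof.
have le12 : (1 <= 2%:E :> \bar R)%E by rewrite lee1n.
move=> f2 g2; apply: (Lfun_addr_closed mu le12).2 => //.
exact: (Lfun_oppr_closed g2).
Qed.

Lemma Lfun2D f g : f \in Lfun mu 2%:E -> g \in Lfun mu 2%:E ->
  (fun x => f x + g x) \in Lfun mu 2%:E.
Proof.
have le12 : (1 <= 2%:E :> \bar R)%E by rewrite lee1n.
by move=> f2 g2; apply: (Lfun_addr_closed mu le12).2.
Qed.

Lemma Lfun2Z k f : f \in Lfun mu 2%:E -> (fun x => k * f x) \in Lfun mu 2%:E.
Proof.
move=> /(@Lfun_scale _ _ _ mu f k 2 (ler1n _ 2)).
by rewrite (_ : k \o* f = fun x => k * f x)//; apply/funext => x /=; rewrite mulrC.
Qed.

Lemma Lfun2_sum (I : finType) (f : I -> T -> R) :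
  (forall i, f i \in Lfun mu 2%:E) -> (fun x => \sum_i f i x) \in Lfun mu 2%:E.
Proof.
have le12 : (1 <= 2%:E :> \bar R)%E by rewrite lee1n.
move=> f2; rewrite (_ : (fun x => _) = \sum_i f i); last first.
  by apply/funext => x; rewrite fct_sumE.
elim/big_ind : _ => // [|g h gi hi]; first exact: (Lfun_addr_closed mu le12).1.
exact: (Lfun_addr_closed mu le12).2.
Qed.

(** Pointwise this is [0 <= (f + g) ^+ 2]. It stands in for the Minkowski inequality wherever only
    convergence to 0 matters. *)
Lemma Rintegral_sqrB_le f g : f \in Lfun mu 2%:E -> g \in Lfun mu 2%:E ->
  \int[mu]_x ((f x - g x) ^+ 2)
    <= 2 * \int[mu]_x (f x ^+ 2) + 2 * \int[mu]_x (g x ^+ 2).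
Proof.
move=> f2 g2.
have fi := Lfun2_integrable_sqr f2; have gi := Lfun2_integrable_sqr g2.
rewrite -!RintegralZl// -RintegralD//; [|exact: integrable_realZ..].
apply: le_Rintegral => //.
- exact: (Lfun2_integrable_sqr (Lfun2B f2 g2)).
- by apply: integrable_realD; exact: integrable_realZ.
- by move=> x _; have := sqr_ge0 (f x + g x); rewrite !expr2; nra.
Qed.

(** The null complement of [D] is discarded before the bound is used. With [D] the domain, this
    serves for test functions and for the permeability, whose bounds hold on the domain only. *)
Lemma integrable_mul_bounded_on (D : set T) (M : R) h f :
  measurable D -> mu (~` D) = 0%E ->
  measurable_fun setT h -> (forall x, D x -> `|h x| <= M) ->
  mu.-integrable setT (EFin \o f) ->
  mu.-integrable setT (EFin \o (fun x => h x * f x)).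
Proof.
move=> mD muD mh hM fi.
have mf : measurable_fun setT f by apply/measurable_EFinP; exact: measurable_int fi.
apply/(negligible_integrable (measurableC mD) measurableT _ muD).
  by apply/measurable_EFinP; exact: measurable_funM.
rewrite setTD setCK.
apply: (@integrableMr _ _ _ mu _ mD h (EFin \o f)).
- exact: measurable_funTS.
- exists M; split; first exact: num_real.
  by move=> y My x Dx /=; apply: (le_trans (hM _ Dx)); exact: ltW.
- exact: integrableS fi.
Qed.

Lemma le_Rintegral_on (D : set T) f g : measurable D -> mu (~` D) = 0%E ->
  mu.-integrable setT (EFin \o f) -> mu.-integrable setT (EFin \o g) ->
  (forall x, D x -> f x <= g x) -> \int[mu]_x f x <= \int[mu]_x g x.
Proof.
move=> mD muD fi gi fg.
rewrite /Rintegral !(negligible_integral (measurableC mD) measurableT _ muD)//.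
rewrite setTD setCK; apply: (@le_Rintegral _ _ _ mu) => //.
- exact: integrableS fi.
- exact: integrableS gi.
Qed.

End integrable_real_functions.

(** * Sobolev functions and traces *)

(** [D] lies in a closed ball, which is compact in finite dimension, and so is the image of that
    ball. *)
Lemma continuous_bounded_on (R : realType) (n : nat) (D : set 'rV[R]_n.+1)
    (phi : 'rV[R]_n.+1 -> R) :
  bounded_set D -> continuous phi -> exists M, forall x, D x -> `|phi x| <= M.
Proof.
move=> /pinfty_ex_gt0[r r0 Dr] cphi.
pose B : set 'rV[R]_n.+1 := [set x | `|x| <= r].
have /compact_bounded/pinfty_ex_gt0[M _ MP] : compact (phi @` B).
  apply: continuous_compact; first exact: continuous_subspaceT.
  apply: bounded_closed_compact.
    exists r; split=> [|y ry x /= xr]; first exact: num_real.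
    by apply: (le_trans xr); exact: ltW.
  rewrite (_ : B = (fun x => `|x|) @^-1` [set y | y <= r])//.
  apply: preimage_closed; last exact: closed_le.
  by move=> x _; exact: norm_continuous.
by exists M => x Dx; apply: MP; exists x => //; exact: Dr.
Qed.

Lemma C_kB (R : realType) (n k : nat) (f g : 'rV[R]_n.+1 -> R) :
  C_k k f -> C_k k g -> C_k k (f - g).
Proof.
elim: k f g => [|k IH] f g /= => [cf cg x|[df Cf] [dg Cg]].
  by apply: continuousB; [exact: cf|exact: cg].
split=> [x|i]; first exact: differentiableB.
rewrite (_ : partial i (f - g) = partial i f - partial i g); first exact: IH.
by apply/funext => x; rewrite /partial deriveB//; exact: diff_derivable.
Qed.

Lemma smoothB (R : realType) (n : nat) (f g : 'rV[R]_n.+1 -> R) :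
  smooth f -> smooth g -> smooth (f - g).
Proof. by move=> sf sg k; apply: C_kB. Qed.

Lemma with_gradientB (R : realType) (n : nat) (f g : 'rV[R]_n.+1 -> R) :
  smooth f -> smooth g ->
  with_gradient (f - g) = with_gradient f - with_gradient g.
Proof.
move=> /(_ 1%N)[df _] /(_ 1%N)[dg _]; congr pair; apply/funext => x.
apply/rowP => i; rewrite !mxE /partial deriveB//; exact: diff_derivable.
Qed.

Lemma dotp_sqr_ge0 (R : realType) (n : nat) (x : 'rV[R]_n) : 0 <= dotp x x.
Proof. by apply: sumr_ge0 => i _; rewrite -expr2 sqr_ge0. Qed.

(** The form in which the two convergences required by [is_trace] pass to differences. *)
Lemma cvg0_of_le_add (R : realType) (a b c : nat -> R) :
  (forall k, 0 <= c k <= 2 * (a k + b k)) ->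
  a @ \oo --> (0 : R) -> b @ \oo --> (0 : R) -> c @ \oo --> (0 : R).
Proof.
move=> cab a0 b0.
apply: (@squeeze_cvgr _ _ _ _ (cst 0) (cst 2 \* (a \+ b))).
- exact: nearW.
- exact: cvg_cst.
- have := cvgM (cvg_cst (2 : R)) (cvgD a0 b0).
  by rewrite addr0 mulr0; apply.
Qed.

Section sobolev.
Context (R : realType) (n : nat) (Omega : set 'rV[R]_n.+1).
Local Notation mu := (lebesgue_on Omega).
Local Notation T := (caratheodory_type (lebesgue_outer_on Omega)).
Implicit Types (v w : scalar_field R n) (u : vector_field R n).

(** The integrability half of [H1], without the weak gradient identity: all that the algebra of the
    bilinear forms requires. *)
Definition L2_field v : Prop :=
  v.1 \in Lfun mu 2%:E /\ forall i, (fun x => v.2 x 0 i) \in Lfun mu 2%:E.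

Lemma L2_fieldB v w : L2_field v -> L2_field w -> L2_field (v - w).
Proof.
move=> [v1 v2] [w1 w2]; split; first exact: (Lfun2B v1 w1).
move=> i; rewrite (_ : (fun x => _) = fun x => v.2 x 0 i - w.2 x 0 i).
  exact: Lfun2B.
by apply/funext => x; rewrite !mxE.
Qed.

Lemma H1_L2_field v : H1 Omega v -> L2_field v.
Proof. by case. Qed.

(** On a domain of finite measure [f] is integrable, and [phi] is measurable and bounded there. *)
Lemma integrable_mul_continuous (f : T -> R) (phi : 'rV[R]_n.+1 -> R) :
  bounded_set Omega -> f \in Lfun mu 2%:E -> continuous phi ->
  mu.-integrable setT (EFin \o (fun x : T => f x * phi x)).
Proof.
move=> bO f2 cphi; have [M phiM] := continuous_bounded_on bO cphi.
have /Lfun1_integrable fi := Lfun_subset12 (lebesgue_on_fin_num bO) f2.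
have := integrable_mul_bounded_on (measurable_domain Omega) (measure_outside Omega)
  (continuous_measurable (Omega := Omega) cphi) phiM fi.
by congr (_.-integrable _ _); apply/funext => x /=; rewrite mulrC.
Qed.

(** The weak gradient identities may be subtracted because all four products are integrable:
    smoothness at orders 0 and 1 makes [phi] and its partial derivatives continuous. *)
Lemma H1B v w : bounded_set Omega -> H1 Omega v -> H1 Omega w -> H1 Omega (v - w).
Proof.
move=> bO Hv Hw; have [vw1 vw2] := L2_fieldB (H1_L2_field Hv) (H1_L2_field Hw).
split=> // phi i tphi.
have [sphi _] := tphi.
have cphi : continuous phi := sphi 0%N.
have cdphi : continuous (partial i phi) := (sphi 1%N).2 i.
have [v1 v2 /(_ _ i tphi) vE] := Hv; have [w1 w2 /(_ _ i tphi) wE] := Hw.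
transitivity (\int[mu]_x (v.1 x * partial i phi x - w.1 x * partial i phi x)).
  by apply: eq_Rintegral => x _; rewrite -mulrBl.
transitivity (- \int[mu]_x (v.2 x 0 i * phi x - w.2 x 0 i * phi x)); last first.
  by congr (- _); apply: eq_Rintegral => x _; rewrite !mxE mulrBl.
rewrite !RintegralB//; first by rewrite vE wE; lra.
all: exact: integrable_mul_continuous.
Qed.

Lemma L2_field_integrable_dotp v :
  L2_field v -> mu.-integrable setT (EFin \o (fun x : T => dotp (v.2 x) (v.2 x))).
Proof.
by move=> [_ v2]; apply: integrable_real_sum => i; exact: Lfun2_integrableM.
Qed.

Lemma H1_normB_le v w : L2_field v -> L2_field w ->
  H1_norm Omega (v - w) <= 2 * (H1_norm Omega v + H1_norm Omega w).
Proof.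
move=> Lv Lw; have Lvw := L2_fieldB Lv Lw.
have H1_ge0 (z : scalar_field R n) :
    0 <= \int[mu]_x (z.1 x ^+ 2) + \int[mu]_x dotp (z.2 x) (z.2 x).
  by rewrite addr_ge0// Rintegral_ge0// => x _; [exact: sqr_ge0|exact: dotp_sqr_ge0].
have le1 := Rintegral_sqrB_le Lv.1 Lw.1.
have le2 : \int[mu]_x dotp ((v - w).2 x) ((v - w).2 x) <=
    2 * \int[mu]_x dotp (v.2 x) (v.2 x) + 2 * \int[mu]_x dotp (w.2 x) (w.2 x).
  have iv := L2_field_integrable_dotp Lv; have iw := L2_field_integrable_dotp Lw.
  rewrite -!RintegralZl// -RintegralD//; [|exact: integrable_realZ..].
  apply: le_Rintegral => //.
  - exact: L2_field_integrable_dotp.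
  - by apply: integrable_realD; exact: integrable_realZ.
  - move=> x _; rewrite /dotp !mulr_sumr -big_split/=; apply: ler_sum => i _.
    by rewrite !mxE; have := sqr_ge0 (v.2 x 0 i + w.2 x 0 i); rewrite !expr2; nra.
(* Comparison of squares: with [a], [b] the two norms, [2 * (a ^+ 2 + b ^+ 2) <= 4 * (a + b) ^+
   2]. *)
rewrite -(@ler_pXn2r _ 2)// ?nnegrE ?mulr_ge0 ?addr_ge0 ?sqrtr_ge0//.
rewrite sqr_sqrtr//.
have := sqr_sqrtr (H1_ge0 v); have := sqr_sqrtr (H1_ge0 w); rewrite -!/(H1_norm _ _).
have := sqrtr_ge0 (\int[mu]_x (v.1 x ^+ 2) + \int[mu]_x dotp (v.2 x) (v.2 x)).
have := sqrtr_ge0 (\int[mu]_x (w.1 x ^+ 2) + \int[mu]_x dotp (w.2 x) (w.2 x)).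
rewrite -!/(H1_norm _ _); move: (H1_norm _ _) (H1_norm _ _) => a b a0 b0.
by rewrite !expr2 in le1 le2 * => ? ?; nra.
Qed.

(** The differences of the two approximating sequences approximate [v - w], in [H1_norm] inside and
    in L^2 on the boundary. *)
Lemma is_traceB v w (tv tw : 'rV[R]_n.+1 -> R) : bounded_set Omega ->
  H1 Omega v -> H1 Omega w -> is_trace Omega v tv -> is_trace Omega w tw ->
  is_trace Omega (v - w) (tv - tw).
Proof.
move=> bO Hv Hw [tv2 [f [fP fv ftv]]] [tw2 [g [gP gw gtw]]].
split; first exact: Lfun2B.
exists (fun k => f k - g k); split.
- move=> k; have [sf Hf f2] := fP k; have [sg Hg g2] := gP k.
  split; [exact: smoothB|by rewrite with_gradientB//; exact: H1B|exact: Lfun2B].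
- apply: cvg0_of_le_add fv gw => k; rewrite sqrtr_ge0/=.
  have [sf Hf f2] := fP k; have [sg Hg g2] := gP k.
  rewrite with_gradientB// (_ : v - w - _ =
    (v - with_gradient (f k)) - (w - with_gradient (g k))).
    by apply: H1_normB_le; apply/L2_fieldB; exact: H1_L2_field.
  by rewrite !opprB addrACA [RHS]addrACA; congr (_ + _); rewrite addrC.
- apply: cvg0_of_le_add ftv gtw => k; apply/andP; split.
    by apply: Rintegral_ge0 => x _; exact: sqr_ge0.
  have [sf Hf f2] := fP k; have [sg Hg g2] := gP k.
  rewrite mulrDr; apply: le_trans (Rintegral_sqrB_le (Lfun2B tv2 f2) (Lfun2B tw2 g2)).
  rewrite le_eqVlt; apply/orP; left; apply/eqP.
  apply: eq_Rintegral => x _; congr (_ ^+ 2); rewrite /=.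
  by change ((tv x - tw x) - (f k x - g k x) = (tv x - f k x) - (tw x - g k x)); ring.
Qed.

Lemma H1_vanishingB (S : set 'rV[R]_n.+1) v w : bounded_set Omega ->
  H1_vanishing Omega S v -> H1_vanishing Omega S w ->
  H1_vanishing Omega S (v - w).
Proof.
move=> bO [Hv [tv [vtv tv0]]] [Hw [tw [wtw tw0]]]; split; first exact: H1B.
exists (tv - tw); split; first exact: is_traceB.
apply: (@filterS2 _ _ (ae_filter_ringOfSetsType (surface_on S)) _ _ _ _ tv0 tw0).
by move=> x vx wx; rewrite !fctE vx wx subrr.
Qed.

(** Vanishing on [D] provides each component with a trace on the whole boundary, hence a normal
    trace on any [S]. *)
Lemma is_normal_trace_ex (S D : set 'rV[R]_n.+1) u :
  H1_vvanishing Omega D u -> exists s, is_normal_trace Omega S u s.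
Proof.
move=> Hu; have /choice[w wP] : forall i, exists t, is_trace Omega (u i) t.
  by move=> i; have [_ [w [? _]]] := Hu i; exists w.
exists (fun x => \sum_i w i x * outer_normal Omega x 0 i), w; split=> //.
exact: nearW.
Qed.

(** Existence rules out the default value of [xget], so that the contact pressure can be evaluated
    at [normal_trace]. *)
Lemma normal_traceP (S D : set 'rV[R]_n.+1) u : H1_vvanishing Omega D u ->
  is_normal_trace Omega S u (normal_trace Omega S u).
Proof.
move=> /(is_normal_trace_ex S)[s us].
by apply: (@xgetPex _ (fun=> 0) [set s | is_normal_trace Omega S u s]); exists s.
Qed.

End sobolev.

(** * The bilinear forms *)

Lemma dotpBr (R : realType) m (x y z : 'rV[R]_m) : dotp x (y - z) = dotp x y - dotp x z.
Proof. by rewrite /dotp -sumrB; apply: eq_bigr => i _; rewrite !mxE mulrBr. Qed.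

Lemma dotpBl (R : realType) m (x y z : 'rV[R]_m) : dotp (x - y) z = dotp x z - dotp y z.
Proof. by rewrite /dotp -sumrB; apply: eq_bigr => i _; rewrite !mxE mulrBl. Qed.

(** The dot product is the entry of a 1 by 1 matrix, which equals its transpose. *)
Lemma dotp_mulmx_sym (R : realType) m (A : 'M[R]_m) (x y : 'rV[R]_m) : A^T = A ->
  dotp (x *m A^T) y = dotp (y *m A^T) x.
Proof.
move=> sA; have dE (z t : 'rV[R]_m) : dotp z t = (z *m t^T) 0 0.
  by rewrite mxE; apply: eq_bigr => i _; rewrite mxE.
have tr1 (B : 'M[R]_1) : B 0 0 = B^T 0 0 by rewrite mxE.
by rewrite sA !dE [LHS]tr1 !trmx_mul trmxK sA mulmxA.
Qed.

Section forms.
Context (R : realType) (n : nat) (Omega : set 'rV[R]_n.+1).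
Local Notation mu := (lebesgue_on Omega).
Local Notation T := (caratheodory_type (lebesgue_outer_on Omega)).
Implicit Types (p q r : scalar_field R n) (u v w : vector_field R n).

Definition L2_vfield u : Prop := forall i, L2_field Omega (u i).

Lemma L2_vfieldB u v : L2_vfield u -> L2_vfield v -> L2_vfield (u - v).
Proof. by move=> Lu Lv i; exact: L2_fieldB. Qed.

Lemma strainB u v x : strain (u - v) x = strain u x - strain v x.
Proof. by apply/matrixP => i j; rewrite !mxE; lra. Qed.

Lemma divgB u v x : divg (u - v) x = divg u x - divg v x.
Proof. by rewrite /divg -sumrB; apply: eq_bigr => i _; rewrite !mxE. Qed.

Lemma Lfun2_strain u i j : L2_vfield u ->
  (fun x => strain u x i j) \in Lfun mu 2%:E.
Proof.
move=> Lu; rewrite (_ : (fun x => _) =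
    fun x => 2^-1 * ((u i).2 x 0 j + (u j).2 x 0 i)).
  by apply: Lfun2Z; apply: Lfun2D; exact: (Lu _).2.
by apply/funext => x; rewrite mxE mulrC.
Qed.

Lemma Lfun2_divg u : L2_vfield u -> divg u \in Lfun mu 2%:E.
Proof. by move=> Lu; apply: Lfun2_sum => i; exact: (Lu _).2. Qed.

(** Gathering each form under one integral turns its bilinearity and symmetry into pointwise
    identities. *)
Definition density_a (tau iota : R) u v (x : 'rV[R]_n.+1) : R :=
  2 * tau * (\sum_i \sum_j strain u x i j * strain v x i j)
  + iota * (divg u x * divg v x).

Definition density_c (iota alpha : R) (kappa : 'rV[R]_n.+1 -> 'M[R]_n.+1) p q
    (x : 'rV[R]_n.+1) : R :=
  alpha ^+ 2 / iota * (p.1 x * q.1 x) + dotp (p.2 x *m (kappa x)^T) (q.2 x).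

Lemma integrable_strain u v : L2_vfield u -> L2_vfield v ->
  mu.-integrable setT
    (EFin \o (fun x : T => \sum_i \sum_j strain u x i j * strain v x i j)).
Proof.
move=> Lu Lv; apply: integrable_real_sum => i; apply: integrable_real_sum => j.
by apply: Lfun2_integrableM; exact: Lfun2_strain.
Qed.

Lemma integrable_density_a tau iota u v : L2_vfield u -> L2_vfield v ->
  mu.-integrable setT (EFin \o (density_a tau iota u v : T -> R)).
Proof.
move=> Lu Lv; apply: integrable_realD; apply: integrable_realZ.
  exact: integrable_strain.
by apply: Lfun2_integrableM; exact: Lfun2_divg.
Qed.

Lemma form_aE tau iota u v : L2_vfield u -> L2_vfield v ->
  form_a Omega tau iota u v = \int[mu]_x density_a tau iota u v x.
Proof.
move=> Lu Lv; have Is := integrable_strain Lu Lv.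
have Id := Lfun2_integrableM (Lfun2_divg Lu) (Lfun2_divg Lv).
by rewrite /form_a -!RintegralZl// -RintegralD//; exact: integrable_realZ.
Qed.

Lemma density_aC tau iota u v : density_a tau iota u v = density_a tau iota v u.
Proof.
apply/funext => x; rewrite /density_a [divg v x * _]mulrC; congr (_ * _ + _).
by apply: eq_bigr => i _; apply: eq_bigr => j _; rewrite mulrC.
Qed.

Lemma density_aBr tau iota u v w x :
  density_a tau iota u (v - w) x = density_a tau iota u v x - density_a tau iota u w x.
Proof.
rewrite /density_a divgB strainB.
rewrite (_ : \sum_i _ = \sum_i \sum_j strain u x i j * strain v x i j
                      - \sum_i \sum_j strain u x i j * strain w x i j).
  by ring.
rewrite -sumrB; apply: eq_bigr => i _; rewrite -sumrB; apply: eq_bigr => j _.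
by rewrite !mxE mulrBr.
Qed.

Lemma form_aC tau iota u v : L2_vfield u -> L2_vfield v ->
  form_a Omega tau iota u v = form_a Omega tau iota v u.
Proof. by move=> Lu Lv; rewrite !form_aE// density_aC. Qed.

Lemma form_aBr tau iota u v w : L2_vfield u -> L2_vfield v -> L2_vfield w ->
  form_a Omega tau iota u (v - w)
  = form_a Omega tau iota u v - form_a Omega tau iota u w.
Proof.
move=> Lu Lv Lw; have Lvw := L2_vfieldB Lv Lw.
rewrite !form_aE// -RintegralB//; try exact: integrable_density_a.
by apply: eq_Rintegral => x _; exact: density_aBr.
Qed.

Lemma form_aBl tau iota u v w : L2_vfield u -> L2_vfield v -> L2_vfield w ->
  form_a Omega tau iota (u - v) w
  = form_a Omega tau iota u w - form_a Omega tau iota v w.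
Proof.
move=> Lu Lv Lw; have Luv := L2_vfieldB Lu Lv.
by rewrite !(form_aC _ _ _ Lw)// form_aBr.
Qed.

Lemma form_a_ge0 tau iota u : 0 <= tau -> 0 <= iota ->
  0 <= form_a Omega tau iota u u.
Proof.
move=> tau0 iota0; rewrite addr_ge0// mulr_ge0// ?mulr_ge0// Rintegral_ge0// => x _.
  by apply: sumr_ge0 => i _; apply: sumr_ge0 => j _; rewrite -expr2 sqr_ge0.
by rewrite -expr2 sqr_ge0.
Qed.

Lemma norm_a_sqr tau iota u : 0 <= tau -> 0 <= iota ->
  norm_a Omega tau iota u ^+ 2 = form_a Omega tau iota u u.
Proof. by move=> ? ?; rewrite sqr_sqrtr// form_a_ge0. Qed.

(** Expansion of [0 <= a(u - 2 v, u - 2 v)], where [u - 2 v] is written with differences only. *)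
Lemma form_a_young tau iota u v : 0 <= tau -> 0 <= iota ->
  L2_vfield u -> L2_vfield v ->
  4 * form_a Omega tau iota u v
    <= form_a Omega tau iota u u + 4 * form_a Omega tau iota v v.
Proof.
move=> tau0 iota0 Lu Lv; have Luv := L2_vfieldB Lu Lv.
have Luvv := L2_vfieldB Luv Lv.
have := form_a_ge0 (u - v - v) tau0 iota0.
rewrite !form_aBr// !form_aBl// (form_aC _ _ Lv Lu)//; lra.
Qed.

Lemma integrable_form_b u q : L2_vfield u -> L2_field Omega q ->
  mu.-integrable setT (EFin \o (fun x : T => divg u x * q.1 x)).
Proof. by move=> Lu Lq; exact: Lfun2_integrableM (Lfun2_divg Lu) Lq.1. Qed.

Lemma form_bBl alpha u v q : L2_vfield u -> L2_vfield v -> L2_field Omega q ->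
  form_b Omega alpha (u - v) q = form_b Omega alpha u q - form_b Omega alpha v q.
Proof.
move=> Lu Lv Lq; rewrite /form_b -mulrBr -RintegralB//; try exact: integrable_form_b.
by congr (_ * _); apply: eq_Rintegral => x _; rewrite divgB mulrBl.
Qed.

Lemma form_bBr alpha u p q : L2_vfield u -> L2_field Omega p -> L2_field Omega q ->
  form_b Omega alpha u (p - q) = form_b Omega alpha u p - form_b Omega alpha u q.
Proof.
move=> Lu Lp Lq; rewrite /form_b -mulrBr -RintegralB//; try exact: integrable_form_b.
by congr (_ * _); apply: eq_Rintegral => x _; rewrite -mulrBr.
Qed.

Section form_c.
Context (iota alpha : R) (kappa : 'rV[R]_n.+1 -> 'M[R]_n.+1).
Context (hkappa : permeability Omega kappa) (iota0 : 0 < iota).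
Local Notation c := (form_c Omega iota alpha kappa).
Local Notation dc := (density_c iota alpha kappa).

(** In coordinates this is a finite sum of integrable products with coefficients [kappa x i j],
    bounded on [Omega]. *)
Lemma integrable_permeability p q : L2_field Omega p -> L2_field Omega q ->
  mu.-integrable setT
    (EFin \o (fun x : T => dotp (p.2 x *m (kappa x)^T) (q.2 x))).
Proof.
move=> Lp Lq; have [mk _ [k1 kle] _] := hkappa.
rewrite (_ : (fun x => _) =
    fun x => \sum_i \sum_j kappa x i j * (p.2 x 0 j * q.2 x 0 i)).
  apply: integrable_real_sum => i; apply: integrable_real_sum => j.
  apply: (integrable_mul_bounded_on (measurable_domain Omega)
    (measure_outside Omega) (mk i j) (fun x Ox => kle x Ox i j)).
  exact: Lfun2_integrableM (Lp.2 j) (Lq.2 i).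
apply/funext => x; apply: eq_bigr => i _; rewrite mxE mulr_suml.
by apply: eq_bigr => j _; rewrite mxE; ring.
Qed.

Lemma integrable_density_c p q : L2_field Omega p -> L2_field Omega q ->
  mu.-integrable setT (EFin \o (dc p q : T -> R)).
Proof.
move=> Lp Lq; apply: integrable_realD; last exact: integrable_permeability.
by apply: integrable_realZ; exact: Lfun2_integrableM Lp.1 Lq.1.
Qed.

Lemma form_cE p q : L2_field Omega p -> L2_field Omega q ->
  c p q = \int[mu]_x dc p q x.
Proof.
move=> Lp Lq; have I1 := Lfun2_integrableM Lp.1 Lq.1.
rewrite /form_c -RintegralZl// -RintegralD//; first exact: integrable_realZ.
exact: integrable_permeability.
Qed.

Lemma form_cBr p q r : L2_field Omega p -> L2_field Omega q -> L2_field Omega r ->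
  c p (q - r) = c p q - c p r.
Proof.
move=> Lp Lq Lr; have Lqr := L2_fieldB Lq Lr.
rewrite !form_cE// -RintegralB//; try exact: integrable_density_c.
by apply: eq_Rintegral => x _; rewrite /density_c dotpBr mulrBr mulrBr; ring.
Qed.

Lemma form_cBl p q r : L2_field Omega p -> L2_field Omega q -> L2_field Omega r ->
  c (p - q) r = c p r - c q r.
Proof.
move=> Lp Lq Lr; have Lpq := L2_fieldB Lp Lq.
rewrite !form_cE// -RintegralB//; try exact: integrable_density_c.
by apply: eq_Rintegral => x _; rewrite /density_c mulmxBl dotpBl mulrBl mulrBr; ring.
Qed.

Lemma permeability_ge0 (x : 'rV[R]_n.+1) (y : 'rV[R]_n.+1) : Omega x ->
  0 <= dotp (y *m (kappa x)^T) y.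
Proof.
move=> Ox; have [_ _ _ [k0 [k0_gt0 kP]]] := hkappa.
by apply: le_trans (kP _ Ox y); rewrite mulr_ge0 ?dotp_sqr_ge0// ltW.
Qed.

Lemma le_form_c p : L2_field Omega p ->
  alpha ^+ 2 / iota * \int[mu]_x (p.1 x ^+ 2) <= c p p.
Proof.
move=> Lp; have I1 := Lfun2_integrable_sqr Lp.1.
rewrite form_cE// -RintegralZl//.
apply: (le_Rintegral_on (measurable_domain Omega) (measure_outside Omega)).
- exact: integrable_realZ.
- exact: integrable_density_c.
- by move=> x Ox; rewrite lerDl permeability_ge0.
Qed.

Lemma form_c_ge0 p : L2_field Omega p -> 0 <= c p p.
Proof.
move=> Lp; apply: le_trans (le_form_c Lp); rewrite mulr_ge0//.
  by rewrite divr_ge0 ?sqr_ge0// ltW.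
by apply: Rintegral_ge0 => x _; exact: sqr_ge0.
Qed.

Lemma norm_c_sqr p : L2_field Omega p ->
  norm_c Omega iota alpha kappa p ^+ 2 = c p p.
Proof. by move=> Lp; rewrite sqr_sqrtr// form_c_ge0. Qed.

Lemma form_cC p q : L2_field Omega p -> L2_field Omega q -> c p q = c q p.
Proof.
move=> Lp Lq; have [_ sk _ _] := hkappa; have mD := measurable_domain Omega.
(* [kappa] is symmetric on [Omega] only, so equality is obtained from two inequalities between
   integrals over the domain. *)
have le a b : L2_field Omega a -> L2_field Omega b -> c a b <= c b a.
  move=> La Lb; rewrite !form_cE//; apply: (le_Rintegral_on mD (measure_outside Omega)).
  - exact: integrable_density_c.
  - exact: integrable_density_c.
  - move=> x Ox; rewrite /density_c mulrC [X in _ * X]mulrC.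
    by rewrite dotp_mulmx_sym ?sk//; lra.
by apply/eqP; rewrite eq_le !le.
Qed.

Lemma form_c_young p q : L2_field Omega p -> L2_field Omega q ->
  4 * c p q <= c p p + 4 * c q q.
Proof.
move=> Lp Lq; have Lpq := L2_fieldB Lp Lq; have Lpqq := L2_fieldB Lpq Lq.
have := form_c_ge0 Lpqq; rewrite !form_cBr// !form_cBl// (form_cC Lq Lp); lra.
Qed.

Lemma le_form_a tau u : 0 <= tau ->
  iota * \int[mu]_x (divg u x ^+ 2) <= form_a Omega tau iota u u.
Proof.
move=> tau0; rewrite /form_a; under eq_Rintegral do rewrite expr2.
rewrite lerDr mulr_ge0 ?mulr_ge0// Rintegral_ge0// => x _.
by apply: sumr_ge0 => i _; apply: sumr_ge0 => j _; rewrite -expr2 sqr_ge0.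
Qed.

(* The constant of continuity of b is 1 in these norms, since alpha is the
   geometric mean of iota and alpha^2 / iota. *)
Lemma form_b_young tau s u q : 0 <= tau -> 0 < s -> L2_vfield u ->
  L2_field Omega q ->
  2 * `|form_b Omega alpha u q| <= s * form_a Omega tau iota u u + s^-1 * c q q.
Proof.
move=> tau0 s0 Lu Lq.
have leA := ler_wpM2l (ltW s0) (le_form_a u tau0).
have sV0 : 0 <= s^-1 by rewrite invr_ge0 ltW.
have leC := ler_wpM2l sV0 (le_form_c Lq).
apply: le_trans (lerD leA leC).
have Id := Lfun2_integrable_sqr (Lfun2_divg Lu).
have Iq := Lfun2_integrable_sqr Lq.1.
have Ib := integrable_form_b Lu Lq.
(* The sign [k] is 1 or -1; the two cases together bound the absolute value. *)
have young k : k ^+ 2 = 1 -> k * (2 * form_b Omega alpha u q) <=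
    s * (iota * \int[mu]_x (divg u x ^+ 2))
    + s^-1 * (alpha ^+ 2 / iota * \int[mu]_x (q.1 x ^+ 2)).
  move=> k1; rewrite /form_b !mulrA -!RintegralZl// -RintegralD//;
    [|exact: integrable_realZ..].
  apply: le_Rintegral => //; first exact: integrable_realZ.
    by apply: integrable_realD; exact: integrable_realZ.
  move=> x _; rewrite -subr_ge0.
  (* Completing the square in [divg u x]; the leftover term in [q.1 x] matches because
     [k ^+ 2 = 1]. *)
  rewrite (_ : _ - _ = s * iota * (divg u x - k * alpha / (s * iota) * q.1 x) ^+ 2).
    by rewrite mulr_ge0 ?sqr_ge0// mulr_ge0// ltW.
  rewrite sqrrB; set d := divg u x; set y := q.1 x.
  rewrite (_ : (k * alpha / (s * iota) * y) ^+ 2 =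
    k ^+ 2 * (alpha / (s * iota) * y) ^+ 2); last ring.
  by rewrite k1; field; rewrite !gt_eqF.
have := young 1 (expr1n _ _); have := young (-1) (sqrr_sign _ 1).
by case: (ger0P (form_b Omega alpha u q)) => ? ? ?; lra.
Qed.

End form_c.
End forms.

(** * The a priori error estimate *)

(** [V] and [Q] are predicates rather than types because the forms are bilinear only on fields whose
    products are integrable. Closure is required under differences only. *)
Section abstract_estimate.
Context (R : realFieldType) (E F : zmodType) (V : set E) (Q : set F).
Context (a : E -> E -> R) (b : E -> F -> R) (c : F -> F -> R) (fe : E -> R).
Context (VB : forall x y, V x -> V y -> V (x - y)).
Context (QB : forall x y, Q x -> Q y -> Q (x - y)).
Context (aBl : forall x y z, V x -> V y -> V z -> a (x - y) z = a x z - a y z).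
Context (aBr : forall x y z, V x -> V y -> V z -> a x (y - z) = a x y - a x z).
Context (bBl : forall x y q, V x -> V y -> Q q -> b (x - y) q = b x q - b y q).
Context (bBr : forall x p q, V x -> Q p -> Q q -> b x (p - q) = b x p - b x q).
Context (cBl : forall p q r, Q p -> Q q -> Q r -> c (p - q) r = c p r - c q r).
Context (cBr : forall p q r, Q p -> Q q -> Q r -> c p (q - r) = c p q - c p r).
Context (feD : forall x y, V x -> V y -> fe (x + y) = fe x + fe y).
Context (u uN v vN : E) (p pM qM : F).
Context (Vu : V u) (VuN : V uN) (Vv : V v) (VvN : V vN).
Context (Qp : Q p) (QpM : Q pM) (QqM : Q qM).
Context (vi : fe (v - u) <= a u (v - u) - b (v - u) p).
Context (viN : fe (vN - uN) <= a uN (vN - uN) - b (vN - uN) pM).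
Context (galerkin : - b u (qM - pM) - c p (qM - pM)
                    = - b uN (qM - pM) - c pM (qM - pM)).
Local Notation e := (u - uN).
Local Notation eta := (u - vN).
Local Notation r := (p - pM).
Local Notation xi := (p - qM).
Local Notation z := (vN - u + v - uN).

(** The two variational inequalities add up to [a e e <= a e eta + b e r - b eta r] plus the
    pressure term. The Galerkin identity, tested with [qM - pM = r - xi], replaces [b e r] by
    [- c r r + b e xi + c r xi]. *)
Lemma energy_error_le :
  a e e + c r r
    <= a e eta - b eta r + b e xi + c r xi + (a u z - b z p - fe z).
Proof.
have zE : z = (vN - uN) + (v - u).
  by rewrite addrAC (addrAC vN) -addrA (addrC (- u)).
have Vz : V z.
  by rewrite zE -[v - u]opprB; apply: (VB); exact: VB.
have Vz2 : V (v - u) := VB Vv Vu; have Vz1 : V (vN - uN) := VB VvN VuN.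
have Ve : V e := VB Vu VuN; have Veta : V eta := VB Vu VvN.
have Qr : Q r := QB Qp QpM; have Qxi : Q xi := QB Qp QqM.
have Qw : Q (qM - pM) := QB QqM QpM.
(* Written as differences, the test directions let every expansion be folded back, so that the final
   inequality is linear in shared terms. *)
have zE1 : vN - uN = z - (v - u) by rewrite zE addrK.
have zE2 : vN - uN = e - eta by rewrite opprB [RHS]addrC subrKA.
have wE : qM - pM = r - xi by rewrite opprB [RHS]addrC subrKA.
have a1 := aBr Vu Vz Vz2; rewrite -zE1 in a1.
have a2 := aBl Vu VuN Vz1.
have a3 := aBr Ve Ve Veta; rewrite -zE2 in a3.
have b1 := bBl Vz Vz2 Qp; rewrite -zE1 in b1.
have b2 := bBr Vz1 Qp QpM.
have b3 := bBl Ve Veta Qr; rewrite -zE2 in b3.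
have b4 := bBr Ve Qr Qxi; rewrite -wE in b4.
have b5 := bBl Vu VuN Qw.
have c1 := cBr Qr Qr Qxi; rewrite -wE in c1.
have c2 := cBl Qp QpM Qw.
have fez : fe z = fe (vN - uN) + fe (v - u) by rewrite zE feD.
by move: vi viN galerkin; lra.
Qed.

Context (aY : forall x y, V x -> V y -> 4 * a x y <= a x x + 4 * a y y).
Context (cY : forall q s, Q q -> Q s -> 4 * c q s <= c q q + 4 * c s s).
Context (bY : forall k x q, 0 < k -> V x -> Q q ->
  2 * `|b x q| <= k * a x x + k^-1 * c q q).
Context (a_ge0 : forall x, V x -> 0 <= a x x).
Context (c_ge0 : forall q, Q q -> 0 <= c q q).

(** With S the pressure term, absorption leaves [a e e + c r r <= 4 * a eta eta + 4 * c xi xi + 2 *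
    S]. As both terms on the left are nonnegative, multiplying by 2 bounds [a e e] with constants 8,
    8, 4, and multiplying by 6 bounds [c r r] with 24, 24, 12. The stated constants dominate
    these. *)
Lemma a_priori_estimate :
  a e e <= 42 * a eta eta + 12 * c xi xi + 4 * (a u z - b z p - fe z) /\
  c r r <= 126 * a eta eta + 39 * c xi xi + 12 * (a u z - b z p - fe z).
Proof.
have Ve : V e := VB Vu VuN; have Veta : V eta := VB Vu VvN.
have Qr : Q r := QB Qp QpM; have Qxi : Q xi := QB Qp QqM.
(* The weights 1/2 for [b e xi] and 2 for [b eta r] are such that each of the four terms costs a
   quarter of [a e e] or of [c r r]. *)
have half0 : 0 < 2^-1 :> R by rewrite invr_gt0.
have ya := aY Ve Veta; have yc := cY Qr Qxi.
have yb1 := bY half0 Ve Qxi; rewrite invrK in yb1.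
have yb2 := bY (ltr0Sn R 1) Veta Qr.
have nb1 := ler_norm (b e xi).
have nb2 := ler_norm (- b eta r); rewrite normrN in nb2.
have a0 := a_ge0 Ve; have a1 := a_ge0 Veta; have c0 := c_ge0 Qr; have c1 := c_ge0 Qxi.
have energy := energy_error_le.
by split; lra.
Qed.

End abstract_estimate.

(** * Application to the Biot contact problem *)

Lemma finite_dim_subspaceB (R : realType) (E : lmodType R) (W V : set E) x y :
  finite_dim_subspace W V -> W x -> W y -> W (x - y).
Proof.
move=> [_ [N [e ->]]] [a _ <-] [b _ <-]; exists (a - b) => //.
by rewrite -sumrB; apply: eq_bigr => i _; rewrite -scalerBl.
Qed.

Theorem theorem4p4 (R : realType) (n : nat) (hd : n.+1 = 2%N \/ n.+1 = 3%N)
  (Omega : set 'rV[R]_n.+1) (hOmega : lipschitz_domain Omega)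
  (Gp Gf Gc Gd Gt : set 'rV[R]_n.+1)
  (hGp : boundary_piece Omega Gp) (hGf : boundary_piece Omega Gf)
  (hGc : boundary_piece Omega Gc) (hGd : boundary_piece Omega Gd)
  (hGt : boundary_piece Omega Gt)
  (hpf : bnd Omega = Gp `|` Gf) (hpf0 : non_overlapping Gp Gf)
  (hcdt : bnd Omega = Gc `|` Gd `|` Gt)
  (hcd0 : non_overlapping Gc Gd) (hct0 : non_overlapping Gc Gt)
  (hdt0 : non_overlapping Gd Gt)
  (hGp_pos : (0 < hausdorff_outer Gp)%E) (hGd_pos : (0 < hausdorff_outer Gd)%E)
  (hdc : closure Gd `&` closure Gc = set0)
  (tau iota alpha : R) (htau : 0 < tau) (hiota : 0 < iota) (halpha : 0 < alpha)
  (kappa : 'rV[R]_n.+1 -> 'M[R]_n.+1) (hkappa : permeability Omega kappa)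
  (fe : vector_field R n -> R)
  (hfe : in_dual (H1_vvanishing Omega Gd) (H1_vnorm Omega) fe)
  (ff : scalar_field R n -> R)
  (hff : in_dual (H1_vanishing Omega Gp) (H1_norm Omega) ff)
  (g : 'rV[R]_n.+1 -> R) (hg : H_half Gc g)
  (hK : contact_set Omega Gd Gc g !=set0)
  (VN : set (vector_field R n)) (hVN : finite_dim_subspace VN (H1_vvanishing Omega Gd))
  (VM : set (scalar_field R n)) (hVM : finite_dim_subspace VM (H1_vanishing Omega Gp))
  (KN : set (vector_field R n)) (hKN : KN `<=` VN) (hKN0 : KN !=set0)
  (hKN_closed : norm_closed (H1_vnorm Omega) VN KN)
  (hKN_convex : convex_set KN)
  (u : vector_field R n) (p : scalar_field R n)
  (hup : biot_solution Omega tau iota alpha kappa fe ff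
           (contact_set Omega Gd Gc g) (H1_vanishing Omega Gp) u p)
  (sigma : ('rV[R]_n.+1 -> R) -> R)
  (hsigma : is_contact_pressure Omega Gd Gc tau iota alpha fe u p sigma)
  (uN : vector_field R n) (pM : scalar_field R n)
  (huNpM : biot_solution Omega tau iota alpha kappa fe ff KN VM uN pM) :
  forall (v vN : vector_field R n) (qM : scalar_field R n),
    contact_set Omega Gd Gc g v -> KN vN -> VM qM ->
    norm_a Omega tau iota (u - uN) ^+ 2
      <= 42 * norm_a Omega tau iota (u - vN) ^+ 2
         + 12 * norm_c Omega iota alpha kappa (p - qM) ^+ 2
         + 4 * sigma (normal_trace Omega Gc (vN - u + v - uN))
    /\
    norm_c Omega iota alpha kappa (p - pM) ^+ 2
      <= 126 * norm_a Omega tau iota (u - vN) ^+ 2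
         + 39 * norm_c Omega iota alpha kappa (p - qM) ^+ 2
         + 12 * sigma (normal_trace Omega Gc (vN - u + v - uN)).
Proof.
move=> v vN qM Kv KvN MqM.
have bO : bounded_set Omega by case: hOmega.
have [[Hu _] Hp u_vi p_eq] := hup; have [KuN MpM uN_vi pM_eq] := huNpM.
have [Hv _] := Kv; have [VNV _] := hVN; have [VMV _] := hVM.
have HuN := VNV _ (hKN _ KuN); have HvN := VNV _ (hKN _ KvN).
have HpM := VMV _ MpM; have HqM := VMV _ MqM.
have VB (x y : vector_field R n) : H1_vvanishing Omega Gd x ->
    H1_vvanishing Omega Gd y -> H1_vvanishing Omega Gd (x - y).
  by move=> Hx Hy i; apply: H1_vanishingB; [|exact: Hx|exact: Hy].
have QB (x y : scalar_field R n) : H1_vanishing Omega Gp x ->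
    H1_vanishing Omega Gp y -> H1_vanishing Omega Gp (x - y).
  exact: H1_vanishingB.
have LV (x : vector_field R n) : H1_vvanishing Omega Gd x -> L2_vfield Omega x.
  by move=> Hx i; apply: H1_L2_field; case: (Hx i).
have LQ (x : scalar_field R n) : H1_vanishing Omega Gp x -> L2_field Omega x.
  by move=> [Hx _]; exact: H1_L2_field.
have Hz : H1_vvanishing Omega Gd (vN - u + v - uN).
  (* Rewritten with differences, the only operation under which the space is known to be closed. *)
  rewrite (_ : vN - u + v = vN - (u - v)); last by rewrite opprB -addrA (addrC (- u)).
  exact: (VB _ _ (VB _ _ HvN (VB _ _ Hu Hv)) HuN).
have [tau0 iota0] := (ltW htau, ltW hiota).
have feD (x y : vector_field R n) : H1_vvanishing Omega Gd x ->
    H1_vvanishing Omega Gd y -> fe (x + y) = fe x + fe y.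
  move=> Hx Hy; have [/(_ 1 x y Hx Hy)] := hfe.
  by rewrite (scale1r x) mul1r.
have Mw := finite_dim_subspaceB hVM MqM MpM.
(* As [VM] lies in the continuous space, [qM - pM] is admissible in both flow equations, whose
   right-hand sides agree. *)
have galerkin := etrans (p_eq _ (VMV _ Mw)) (esym (pM_eq _ Mw)).
(* The pressure term becomes [a u z - b z p - fe z], the expression of the abstract estimate. *)
rewrite (hsigma _ _ Hz (normal_traceP Gc Hz)).
rewrite !(norm_a_sqr _ _ tau0 iota0) !(norm_c_sqr _ hkappa hiota);
  [|exact/LQ/QB..].
apply: (@a_priori_estimate R _ _ (H1_vvanishing Omega Gd) (H1_vanishing Omega Gp)
  (form_a Omega tau iota) (form_b Omega alpha) (form_c Omega iota alpha kappa) fe);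
  try assumption.
- by move=> x y z /LV Lx /LV Ly /LV Lz; exact: form_aBl.
- by move=> x y z /LV Lx /LV Ly /LV Lz; exact: form_aBr.
- by move=> x y q /LV Lx /LV Ly /LQ Lq; exact: form_bBl.
- by move=> x q r /LV Lx /LQ Lq /LQ Lr; exact: form_bBr.
- by move=> q r s /LQ Lq /LQ Lr /LQ Ls; exact: form_cBl.
- by move=> q r s /LQ Lq /LQ Lr /LQ Ls; exact: form_cBr.
- exact: u_vi.
- exact: uN_vi.
- by move=> x y /LV Lx /LV Ly; exact: form_a_young.
- by move=> q s /LQ Lq /LQ Ls; exact: form_c_young.
- by move=> k x q k0 /LV Lx /LQ Lq; exact: form_b_young.
- by move=> x /LV Lx; exact: form_a_ge0.
- by move=> q /LQ Lq; exact: form_c_ge0.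
Qed.
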